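(* Let $f_n$ denote the number of facets of ${\cal H}(B(n))$. Then (i) $f_n<n!\,n^{n-2}$ for every $n\ge2$; (ii) $f_n>2^{n-2}n^{n-2}$ for every $n\ge4$.
   Context: For $n\ge1$, $B(n)$ denotes the aperiodic Brandt semigroup: the set $(\{1,\dots,n\}\times\{1,\dots,n\})\cup\{0\}$, where $0$ is a zero element and $(i,j)(k,l)=(i,l)$ if $j=k$ and $(i,j)(k,l)=0$ otherwise. For $Y\subseteq B(n)$, $Y^+$ denotes the subsemigroup generated by $Y$ ($\emptyset^+=\emptyset$). The subsemigroup complex ${\cal H}(B(n))$ has vertex set $B(n)$, and a subset $X$ is a face iff it admits an enumeration $x_1,\dots,x_k$ with $\emptyset\subset\{x_1\}^+\subset\cdots\subset\{x_1,\dots,x_k\}^+$ (all inclusions strict); a facet is a face maximal under inclusion. *)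

(* Defs.v *)
From HB Require Import structures.
From mathcomp Require Import all_boot.

Set Implicit Arguments.
Unset Strict Implicit.
Unset Printing Implicit Defensive.

Import Algebra.

(* [None] is the zero element; the index set {1, ..., n} is represented by
   'I_n = {0, ..., n-1}. *)
Definition brandt (n : nat) : Type := option ('I_n * 'I_n).

HB.instance Definition _ (n : nat) := Finite.on (brandt n).

Definition brandt_mul (n : nat) (x y : brandt n) : brandt n :=
  match x, y with
  | Some (i, j), Some (k, l) => if j == k then Some (i, l) else None
  | _, _ => None
  end.

Lemma brandt_mulA (n : nat) : associative (@brandt_mul n).
Proof.
move=> [[a b]|] [[c d]|] [[e f]|] //=.
- by case: (d =P e) => [->|/eqP/negPf dNe]; case: (b == c); rewrite //= ?eqxx ?dNe.
- by case: (b == c).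
Qed.

HB.instance Definition _ (n : nat) :=
  isSemigroup.Build (brandt n) (@brandt_mulA n).

Section SubsemigroupComplex.

Variable n : nat.

Implicit Types (A X Y : {set brandt n}).

(* The empty set counts as a subsemigroup. *)
Definition subsemigroup A : bool :=
  [forall x in A, forall y in A, (x * y)%g \in A].

Lemma subsemigroupP A : reflect (mulg_closed A) (subsemigroup A).
Proof.
apply: (iffP forall_inP) => [cA x y Ax Ay | cA x Ax].
  exact: (forall_inP (cA x Ax)).
by apply/forall_inP => y Ay; apply: cA.
Qed.

Definition subsemigroup_gen Y : {set brandt n} :=
  \bigcap_(A : {set brandt n} | subsemigroup A && (Y \subset A)) A.

Lemma subsemigroup_gen0 : subsemigroup_gen set0 = set0.
Proof.
apply/eqP; rewrite -subset0; apply: bigcap_inf; rewrite sub0set andbT.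
by apply/subsemigroupP => x y; rewrite inE.
Qed.

(* The strict inclusions for i = 0, 1, ..., size s - 1 form the chain
   set0 < {x_1}^+ < ... < {x_1, ..., x_k}^+ with s = [:: x_1; ...; x_k]
   (see subsemigroup_gen0 for the first term). *)
Definition strict_gen_chain (s : seq (brandt n)) : bool :=
  [forall i : 'I_(size s),
     subsemigroup_gen [set x in take i s]
       \proper subsemigroup_gen [set x in take i.+1 s]].

(* A tuple of length #|X| whose set of entries is X has no repetition. *)
Definition face X : bool :=
  [exists s : #|X|.-tuple (brandt n),
     ([set x in s] == X) && strict_gen_chain s].

Definition facet X : bool := maxset face X.

End SubsemigroupComplex.

Definition num_facets (n : nat) : nat := #|[set X : {set brandt n} | facet X]|.

(* Main.v *)
Require Import Defs.
From mathcomp Require Import all_boot.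
From mathcomp Require Import all_fingroup.
From mathcomp Require Import zify.

(* The zero belongs to every facet, so a facet is a set of arcs (i, j), loops
   included.  The last arc of an enumeration of a face is the only arc from A
   to B for some partition of the vertices into A and B, and recursively for
   the arcs inside A and inside B; so the facets are the arc sets obtained by
   always adding all the arcs from B to A and a single arc from A to B.  The
   pairs of vertices joined in both directions then form a spanning tree, and
   all the other arcs agree with a linear order.

   Upper bound: a facet is determined by a linear order and the Pruefer code of
   its tree, and these data are redundant.  Lower bound: a Pruefer code with a
   bit at each step, telling whether the leaf being removed is placed first or
   last, determines a facet; these facets are distinct, and a star whose first
   removed leaf is second in the order is not among them. *)

Set Implicit Arguments.
Unset Strict Implicit.
Unset Printing Implicit Defensive.

(** * Maximal arc sets *)

Section Saturated.

Variable T : finType.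
Implicit Types (A B V : {set T}) (E F D Z C : {set T * T}) (x y u v c : T).

(** The vertex set is carried along because the splitting recurses on both sides. A relation is used
    since the same arc set can arise from several splittings. *)
Inductive saturated : {set T} -> {set T * T} -> Prop :=
| saturated1 v : saturated [set v] [set (v, v)]
| saturatedU A B E F a b :
    [disjoint A & B] -> a \in A -> b \in B -> saturated A E -> saturated B F ->
    saturated (A :|: B) ((a, b) |: (E :|: F :|: setX B A)).

Lemma saturated_sub V E : saturated V E -> E \subset setX V V.
Proof.
elim=> [v|A B {}E F a b dAB aA bB _ sE _ sF]; apply/subsetP => -[x y].
  by rewrite !inE => /eqP[-> ->]; rewrite eqxx.
rewrite !inE => /orP[/eqP[-> ->]|/orP[/orP[|]|/andP[-> ->]]].
- by rewrite aA bB orbT.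
- by move/(subsetP sE); rewrite !inE => /andP[-> ->].
- by move/(subsetP sF); rewrite !inE => /andP[-> ->]; rewrite !orbT.
- by rewrite orbT.
Qed.

Lemma saturated_in V E x y : saturated V E -> (x, y) \in E -> (x \in V) && (y \in V).
Proof. by move=> /saturated_sub/subsetP sE /sE; rewrite !inE. Qed.

(** The count is that of a reflexive linear order plus one reversed arc for each of the [#|V| - 1]
    tree edges, written without division or subtraction. It depends on [V] only, so no saturated set
    on [V] properly contains another. *)
Lemma saturated_card V E : saturated V E -> 2 * #|E| + 2 = #|V| ^ 2 + 3 * #|V|.
Proof.
elim=> [v|A B {}E F a b dAB aA bB sE IHE sF IHF]; first by rewrite !cards1.
rewrite cardsU1 !cardsU !cardsX (disjoint_setI0 dAB) cards0.
have -> : E :&: F = set0.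
  apply/setP => -[x y]; rewrite !inE; apply/negP => /andP[/(saturated_in sE)].
  move=> /andP[xA _] /(saturated_in sF) /andP[xB _].
  by rewrite (disjointFr dAB xA) in xB.
have -> : (E :|: F) :&: setX B A = set0.
  apply/setP => -[x y]; rewrite !inE; apply/negP => /andP[/orP[|]].
    move=> /(saturated_in sE)/andP[xA _] /andP[xB _].
    by rewrite (disjointFr dAB xA) in xB.
  move=> /(saturated_in sF)/andP[_ yB] /andP[_ yA].
  by rewrite (disjointFr dAB yA) in yB.
have -> : (a, b) \notin E :|: F :|: setX B A.
  rewrite !inE (disjointFr dAB aA) /= orbF.
  apply/negP => /orP[/(saturated_in sE)|/(saturated_in sF)].
    by rewrite andbC; case: (boolP (b \in A)) => // /(disjointFr dAB); rewrite bB.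
  by rewrite (disjointFr dAB aA).
rewrite cards0 !subn0 /= sqrnD; move: #|E| #|F| #|A| #|B| IHE IHF => *; lia.
Qed.

Definition transitive_set C : Prop :=
  forall x y z, (x, y) \in C -> (y, z) \in C -> (x, z) \in C.

(** A transitive set together with zero is a subsemigroup, so [C] certifies that [e] is not
    generated by the rest of [Z]. The arc [e] is [(a, b)] if [Z] contains it; otherwise it is sought
    inside [A], then inside [B], then among the arcs from [B] to [A]. *)
Lemma saturated_escape V E Z :
    saturated V E -> Z \subset E -> Z != set0 ->
  exists e C, [/\ e \in Z, transitive_set C, Z :\ e \subset C & e \notin C].
Proof.
move=> sE; elim: sE Z => [v|A B {}E F a b dAB aA bB sE IHE sF IHF] Z sZ nZ.
  exists (v, v), set0; split; rewrite ?inE //.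
  - case/set0Pn: nZ => e eZ; have /set1P <- := subsetP sZ _ eZ; exact: eZ.
  - by move=> x y z; rewrite inE.
  - by rewrite subDset setU0.
have dBA x : x \in B -> (x \in A) = false by move=> xB; apply: (disjointFl dAB).
have dAB' x (xA : x \in A) := disjointFr dAB xA.
have [abZ|abZ] := boolP ((a, b) \in Z).
  (* The arcs that do not leave [A] form a transitive set, and [(a, b)] is the only arc leaving
     [A]. *)
  exists (a, b), [set e | (e.1 \in A) ==> (e.2 \in A)]; split => //.
  - by move=> x y z; rewrite !inE /=; do 3 case: (_ \in A).
  - apply/subsetP => -[x y]; rewrite !inE => /andP[/negPf ne /(subsetP sZ)].
    rewrite !inE ne /= => /orP[/orP[|]|].
    + by case/(saturated_in sE)/andP => _ ->; rewrite implybT.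
    + by case/(saturated_in sF)/andP => /dBA ->.
    + by case/andP => _ ->; rewrite implybT.
  - by rewrite !inE /= aA (dBA b).
have sZ' : Z \subset E :|: F :|: setX B A.
  apply/subsetP => e eZ; have := subsetP sZ _ eZ; rewrite !inE.
  by case/orP => // /eqP ee; rewrite -ee eZ in abZ.
have [ZE|ZE] := eqVneq (Z :&: E) set0; last first.
  have [[u v] [C [uvZ tC sC uvC]]] := IHE _ (subsetIr Z E) ZE.
  have /andP[uvZ' uvE] : (((u, v) \in Z) && ((u, v) \in E)) by rewrite -in_setI.
  have /andP[uA vA] := saturated_in sE uvE.
  exists (u, v), [set e | (e.1 \in A) ==> (e.2 \in A) && (e \in C)]; split => //.
  - move=> x y z; rewrite !inE /=.
    case: (x \in A) => //= /andP[-> xyC] /= /andP[-> yzC] /=.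
    exact: tC yzC.
  - apply/subsetP => -[x y]; rewrite in_setD1 => /andP[ne xyZ].
    have := subsetP sZ' _ xyZ; rewrite !inE => /orP[/orP[xyE|xyF]|/andP[xB yA]].
    + have /andP[-> ->] /= := saturated_in sE xyE.
      by apply: (subsetP sC); rewrite !inE ne xyZ.
    + by case/andP: (saturated_in sF xyF) => /dBA ->.
    + by rewrite /= dBA.
  - by rewrite !inE /= uA vA.
have [ZF|ZF] := eqVneq (Z :&: F) set0; last first.
  have [[u v] [C [uvZ tC sC uvC]]] := IHF _ (subsetIr Z F) ZF.
  have /andP[uvZ' uvF] : (((u, v) \in Z) && ((u, v) \in F)) by rewrite -in_setI.
  have /andP[uB vB] := saturated_in sF uvF.
  (* Dually, no arc of [Z] enters [B] from outside, so only arcs ending in [B] are restricted. *)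
  exists (u, v), [set e | (e.2 \in B) ==> (e.1 \in B) && (e \in C)]; split => //.
  - move=> x y z; rewrite !inE /= => xyC.
    case: (z \in B) => //= /andP[yB yzC].
    by move: xyC; rewrite yB /= => /andP[-> xyC] /=; apply: tC yzC.
  - apply/subsetP => -[x y]; rewrite in_setD1 => /andP[ne xyZ].
    have := subsetP sZ' _ xyZ; rewrite !inE => /orP[/orP[xyE|xyF]|/andP[xB yA]].
    + by case/andP: (saturated_in sE xyE) => _ /dAB' /= ->.
    + have /andP[-> ->] /= := saturated_in sF xyF.
      by apply: (subsetP sC); rewrite !inE ne xyZ.
    + by rewrite /= dAB'.
  - by rewrite !inE /= uB vB.
have sBA : Z \subset setX B A.
  apply/subsetP => e eZ; have := subsetP sZ' _ eZ; rewrite 2!in_setU.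
  move/setP/(_ e): ZE; move/setP/(_ e): ZF; rewrite !inE eZ /=.
  by move=> -> ->.
(* Two arcs from [B] to [A] never compose, so [Z :\ e] is vacuously transitive for any [e]. *)
have [e eZ] := set0Pn _ nZ.
exists e, (Z :\ e); split; rewrite ?setD11 //.
move=> x y z; rewrite 2!in_setD1 => /andP[_ xyZ] /andP[_ yzZ].
have := subsetP sBA _ xyZ; have := subsetP sBA _ yzZ; rewrite !inE /=.
by case/andP => /dBA ->; rewrite andbF.
Qed.

(* The last arc (u, v) of an enumeration is the only arc leaving the set of
   vertices reachable from u by the other arcs. *)
Lemma sub_saturated V F :
    V != set0 -> F \subset setX V V ->
    (forall Z, Z \subset F -> Z != set0 -> (forall e, e \in Z -> e.1 != e.2) ->
      exists2 e, e \in Z & ~~ connect (fun x y => (x, y) \in Z :\ e) e.1 e.2) ->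
  exists2 E, saturated V E & F \subset E.
Proof.
have [m] := ubnP #|V|; elim: m => // m IHm in V F *; rewrite ltnS => leVm nV sF hF.
have [V1|V1] := leqP #|V| 1.
  have /cards1P[v Vv] : #|V| == 1 by rewrite eqn_leq V1 card_gt0.
  exists [set (v, v)]; first by rewrite Vv; constructor.
  apply/subsetP => -[x y] /(subsetP sF); rewrite Vv !inE /=.
  by case/andP => /eqP-> /eqP->.
pose Z := [set e in F | e.1 != e.2].
have [e [e1V e2V ne ncon]] : exists e : T * T,
    [/\ e.1 \in V, e.2 \in V, e.1 != e.2
      & ~~ connect (fun x y => (x, y) \in Z :\ e) e.1 e.2].
  (* If [F] has loops only, any two distinct vertices are unconnected and give an [e], which then
     need not belong to [F]. *)
  have [Z0|nZ] := eqVneq Z set0.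
    have [x [y [xV yV nxy]]] := card_gt1P V1.
    exists (x, y); split=> //=; apply/negP => /connectP[[|z p] /=].
      by move=> _ yx; rewrite yx eqxx in nxy.
    by rewrite Z0 !inE andbF.
  have sZ : Z \subset F by apply/subsetP => e /setIdP[].
  have lZ e : e \in Z -> e.1 != e.2 by case/setIdP.
  have [[x y] eZ nc] := hF Z sZ nZ lZ.
  have /setIdP[/(subsetP sF)/setXP[xV yV] ne] := eZ.
  by exists (x, y).
set R := connect _ in ncon.
pose A := [set x in V | R e.1 x]; pose B := V :\: A.
have e1A : e.1 \in A by rewrite inE e1V /R connect0.
have e2B : e.2 \in B by rewrite !inE e2V (negPf ncon).
have sAV : A \subset V by apply/subsetP => x; rewrite inE => /andP[].
have VAB : V = A :|: B by rewrite /B setDE setUIr setUCr setIT; symmetry; apply/setUidPr.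
have dAB : [disjoint A & B].
  rewrite -setI_eq0; apply/eqP/setP=> x; rewrite in_set0 in_setI in_setD.
  by case: (x \in A).
have cVAB : #|V| = #|A| + #|B|.
  by rewrite {1}VAB cardsU (disjoint_setI0 dAB) cards0 subn0.
have A0 : 0 < #|A| by apply/card_gt0P; exists e.1.
have B0 : 0 < #|B| by apply/card_gt0P; exists e.2.
have sub (W : {set T}) : 0 < #|W| -> #|W| < m ->
    exists2 E, saturated W E & F :&: setX W W \subset E.
  rewrite card_gt0 => nW Wm; apply: IHm => // [|Z' /subsetIP[sZ' _]].
    exact: subsetIr.
  exact: hF.
have [EA sEA FA] := sub A A0 ltac:(lia).
have [EB sEB FB] := sub B B0 ltac:(lia).
exists (e |: (EA :|: EB :|: setX B A)).
  rewrite {1}VAB (surjective_pairing e); exact: saturatedU.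
apply/subsetP => -[x y] xyF.
have /setXP[] := subsetP sF _ xyF; rewrite VAB 2!(in_setU _ A B) => /orP[xA|xB] /orP[yA|yB].
- have /(subsetP FA) : (x, y) \in F :&: setX A A by rewrite in_setI in_setX xyF /= xA.
  by move=> xyE; rewrite !in_setU xyE ?orbT.
(* An arc of [F] from [A] to [B] other than [e] would make its end reachable from [e.1], hence a
   member of [A]. *)
- rewrite in_setU1; have [//|nexy /=] := eqVneq (x, y) e; exfalso.
  have /setDP[yV yA] := yB; have /setIdP[xV Rx] := xA.
  case/negP: yA; rewrite inE yV; apply: connect_trans Rx (connect1 _).
  rewrite /= !inE nexy xyF; apply: contraTneq yB => /= <-.
  by rewrite !in_setD xA.
- by rewrite in_setU1 !in_setU in_setX /= xB yA !orbT.
- have /(subsetP FB) : (x, y) \in F :&: setX B B by rewrite in_setI in_setX xyF /= xB.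
  by move=> xyE; rewrite !in_setU xyE ?orbT.
Qed.

End Saturated.

(** * The facets of the complex *)

Section Faces.

Variable n : nat.
Implicit Types (X Y : {set brandt n}) (E Z C : {set 'I_n * 'I_n}) (x y : brandt n).

Local Notation gen := (@subsemigroup_gen n).

(** * Generated subsemigroups and a criterion for faces *)

Lemma sub_gen Y : Y \subset gen Y.
Proof. by apply/bigcapsP => A /andP[]. Qed.

Lemma gen_min A Y : subsemigroup A -> Y \subset A -> gen Y \subset A.
Proof. by move=> cA sYA; apply: bigcap_inf; rewrite cA. Qed.

Lemma gen_mul Y x y : x \in gen Y -> y \in gen Y -> brandt_mul x y \in gen Y.
Proof.
move=> /bigcapP gx /bigcapP gy; apply/bigcapP => A hA.
have /andP[/subsemigroupP cA _] := hA.
exact: cA (gx _ hA) (gy _ hA).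
Qed.

Lemma gen_sub Y Y' : Y \subset Y' -> gen Y \subset gen Y'.
Proof.
move=> sYY'; apply: gen_min (subset_trans sYY' (sub_gen _)).
by apply/subsemigroupP => x y; apply: gen_mul.
Qed.

Lemma gen_id Y x : x \in gen Y -> gen (x |: Y) \subset gen Y.
Proof.
move=> xY; apply: gen_min; first by apply/subsemigroupP => ? ?; apply: gen_mul.
by rewrite subUset sub1set xY sub_gen.
Qed.

(** Adding an element enlarges the generated subsemigroup exactly when that element was not
    generated before. *)
Lemma strict_gen_chainP (s : seq (brandt n)) :
  reflect (forall i, i < size s -> nth None s i \notin gen [set x in take i s])
          (strict_gen_chain s).
Proof.
have setE i : i < size s ->
    [set x in take i.+1 s] = nth None s i |: [set x in take i s].
  by move=> lt; apply/setP=> x; rewrite (take_nth None lt) !inE mem_rcons inE.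
apply: (iffP forallP) => [h i lti|h i].
  apply: contraTN (h (Ordinal lti)) => /gen_id; rewrite /= -setE // => sub.
  by rewrite properE sub andbF.
rewrite setE // properE gen_sub ?subsetUr //=.
apply: contraNN (h i (ltn_ord i)) => /subsetP; apply.
by apply: (subsetP (sub_gen _)); rewrite setU11.
Qed.

Lemma face_seqP X :
  reflect (exists s, [/\ size s = #|X|, s =i X & strict_gen_chain s]) (face X).
Proof.
apply: (iffP existsP) => [[s /andP[/eqP sX cs]]|[s [sz sX cs]]].
  exists s; split; rewrite ?size_tuple // => x.
  by have /setP/(_ x) := sX; rewrite inE.
have szb : size s == #|X| by apply/eqP.
exists (Tuple szb); apply/andP; split=> //.
by apply/eqP/setP => x; rewrite inE /= sX.
Qed.

(** This criterion does not mention enumerations. Given an enumeration, the latest entry in [Y] is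
    not generated by the others, which all come earlier; conversely, an enumeration is built from
    its end. *)
Lemma faceP X :
  reflect (forall Y, Y \subset X -> Y != set0 -> exists2 y, y \in Y & y \notin gen (Y :\ y))
          (face X).
Proof.
apply: (iffP (face_seqP X)) => [[s [_ sX /strict_gen_chainP sP]] Y sYX nY|].
  have ms y : y \in Y -> y \in s by move/(subsetP sYX); rewrite sX.
  have [i iY imax] : exists2 i, (i < size s) && (nth None s i \in Y)
      & forall j, j < size s -> nth None s j \in Y -> j <= i.
    pose P i := (i < size s) && (nth None s i \in Y).
    have exP : exists i, P i.
      have [y yY] := set0Pn _ nY; exists (index y s).
      by rewrite /P index_mem nth_index ?ms.
    have ubP i : P i -> i <= size s by case/andP => /ltnW.
    case: (ex_maxnP exP ubP) => i Pi mi; exists i => // j lj jY; apply: mi.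
    by rewrite /P lj.
  have {iY}[lti iY] := andP iY.
  exists (nth None s i) => //; apply: contraNN (sP i lti); apply/subsetP/gen_sub.
  apply/subsetP => y; rewrite !inE => /andP[ny yY].
  have ys := ms _ yY.
  have ltys : index y s < size s by rewrite index_mem.
  have := imax _ ltys; rewrite nth_index // => /(_ yY).
  rewrite leq_eqVlt => /orP[/eqP eqi|lt].
    by rewrite -eqi nth_index // eqxx in ny.
  rewrite -(nth_index None ys) -(nth_take None lt) mem_nth //.
  by rewrite size_take lti.
have [m] := ubnP #|X|; elim: m => // m IHm in X *; rewrite ltnS => leX hX.
have [X0|nX] := eqVneq X set0.
  by exists [::]; rewrite X0 cards0; split=> [//|x|]; [rewrite !inE | apply/strict_gen_chainP].
(* This [y] is placed last, after an enumeration of [X :\ y]. *)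
have [y yX ygen] := hX X (subxx _) nX.
have cX : #|X| = #|X :\ y|.+1 by rewrite (cardsD1 y) yX.
have [||s [sz sX /strict_gen_chainP sP]] := IHm (X :\ y).
- by rewrite -ltnS -cX ltnS in leX *.
- by move=> Y sY; apply: hX; apply: subset_trans sY (subD1set _ _).
exists (rcons s y); split=> [|x|]; first by rewrite size_rcons sz cX.
  by rewrite mem_rcons inE sX !inE; case: eqP => // ->.
apply/strict_gen_chainP => i /=; rewrite size_rcons ltnS leq_eqVlt.
rewrite nth_rcons -cats1; case/orP => [/eqP ->|lti].
  rewrite ltnn eqxx take_size_cat //.
  by have -> : [set x in s] = X :\ y by apply/setP => x; rewrite inE.
by rewrite lti take_cat lti; apply: sP.
Qed.

(** * Faces and facets as arc sets *)

Definition with_zero E : {set brandt n} := None |: [set Some e | e in E].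

Lemma mem_with_zero E x : (x \in with_zero E) = if x is Some e then e \in E else true.
Proof.
rewrite /with_zero in_setU1; case: x => [e|]; last by rewrite eqxx.
by rewrite /= mem_imset // => ? ? [].
Qed.

Lemma with_zero_inj : injective with_zero.
Proof.
by move=> E F EF; apply/setP=> e; have /setP/(_ (Some e)) := EF; rewrite !mem_with_zero.
Qed.

Lemma with_zero_sub E F : (with_zero E \subset with_zero F) = (E \subset F).
Proof.
apply/subsetP/subsetP => [h e eE|h [e|]]; rewrite ?mem_with_zero //; last exact: h.
by have := h (Some e); rewrite !mem_with_zero; apply.
Qed.

Lemma sub_with_zero X : X \subset with_zero [set e | Some e \in X].
Proof. by apply/subsetP => -[e|] eX; rewrite mem_with_zero // inE. Qed.

Lemma card_with_zero E : #|with_zero E| = #|E|.+1.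
Proof.
rewrite cardsU1 card_imset; last by move=> ? ? [].
by case: imsetP => // -[].
Qed.

(** The product of two arcs is either zero or their composite, which transitivity keeps in [C]. *)
Lemma subsemigroup_with_zero C : transitive_set C -> subsemigroup (with_zero C).
Proof.
move=> tC; apply/subsemigroupP => x y.
rewrite -[(x * y)%g]/(brandt_mul x y) !mem_with_zero.
case: x y => [[i j]|] [[k l]|] //= ijC klC.
by case: (j =P k) => // jk; rewrite -jk in klC; apply: tC klC.
Qed.

Lemma saturated_face V E : saturated V E -> face (with_zero E).
Proof.
move=> sE; apply/faceP => Y sY nY; pose Z := [set e | Some e \in Y].
(* If [Y] contains no arc, it consists of zero alone, and the empty set generates nothing. *)
have [Z0|nZ] := eqVneq Z set0.
  have noS e : Some e \in Y = false by have /setP/(_ e) := Z0; rewrite !inE.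
  have YN : Y = [set None].
    have [[e|]] := set0Pn _ nY; first by rewrite noS.
    by move=> NY; apply/setP => -[e|]; rewrite inE ?noS ?NY.
  by exists None; rewrite YN ?set11 // setDv subsemigroup_gen0 inE.
have sZE : Z \subset E.
  by apply/subsetP => e; rewrite inE => /(subsetP sY); rewrite mem_with_zero.
have [e [C [eZ tC sC eC]]] := saturated_escape sE sZE nZ.
exists (Some e); first by rewrite inE in eZ.
have : Some e \notin with_zero C by rewrite mem_with_zero.
apply: contraNN; apply/subsetP/gen_min; first exact: subsemigroup_with_zero.
apply/subsetP => -[f|]; rewrite mem_with_zero // => /setD1P[nf fY].
by apply: (subsetP sC); rewrite !inE fY andbT; apply: contra_neq nf => ->.
Qed.

(** The product of the arcs along a path from [i] to [j] is the arc [(i, j)]; since [i != j], the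
    path is not empty. *)
Lemma connect_gen Z i j :
  i != j -> connect (fun k l => (k, l) \in Z) i j -> Some (i, j) \in gen [set Some e | e in Z].
Proof.
move=> nij /connectP[p]; case: (lastP p) => [_ ji|{}p k].
  by rewrite ji eqxx in nij.
rewrite last_rcons => + ->.
elim/last_ind: p k => [|p l IHp] k; rewrite rcons_path.
  rewrite /= => ikZ; apply: (subsetP (sub_gen _)); exact: imset_f.
case/andP => /IHp il; rewrite last_rcons => lkZ.
have lk : Some (l, k) \in gen [set Some e | e in Z].
  apply: (subsetP (sub_gen _)); exact: imset_f.
by have := gen_mul il lk; rewrite /= eqxx.
Qed.

(** By [connect_gen], an arc not generated by the others has ends that the others do not connect, so
    [faceP] supplies the hypothesis of [sub_saturated]. *)
Lemma face_sub_saturated X :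
  0 < n -> face X -> exists2 E, saturated setT E & X \subset with_zero E.
Proof.
move=> n0 /faceP hX.
have [|||E sE FE] := @sub_saturated _ setT [set e | Some e \in X].
- by rewrite -card_gt0 cardsT card_ord.
- by apply/subsetP => e _; rewrite !inE.
- move=> Z sZ nZ lZ.
  have [||y] := hX [set Some e | e in Z].
  + by apply/subsetP => _ /imsetP[e eZ ->]; have := subsetP sZ _ eZ; rewrite inE.
  + by have [e eZ] := set0Pn _ nZ; apply/set0Pn; exists (Some e); apply: imset_f.
  case/imsetP => -[i j] eZ -> nge; exists (i, j) => //.
  apply: contraNN nge => con; have /= nij := lZ _ eZ.
  have := connect_gen nij con; apply/subsetP/gen_sub.
  apply/subsetP => _ /imsetP[e /setD1P[ne eZ'] ->].
  rewrite !inE imset_f // andbT; apply: contra_neq ne; by case.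
- by exists E => //; apply: subset_trans (sub_with_zero X) _; rewrite with_zero_sub.
Qed.

(** Every face lies in a saturated one, and all saturated sets on the full vertex set have the same
    size, so these are exactly the maximal faces. *)
Lemma facetP X :
  0 < n -> reflect (exists2 E, saturated setT E & X = with_zero E) (facet X).
Proof.
move=> n0; apply: (iffP (@maxsetP _ _ _)) => [[fX mX]|[E sE ->]].
  have [E sE XE] := face_sub_saturated n0 fX.
  by exists E => //; rewrite (mX _ (saturated_face sE) XE).
split=> [|Y fY sEY]; first exact: saturated_face sE.
have [F sF YF] := face_sub_saturated n0 fY.
apply/eqP; rewrite eq_sym eqEcard sEY (leq_trans (subset_leq_card YF)) //.
rewrite !card_with_zero ltnS.
move/eqP: (saturated_card sF).
by rewrite -(saturated_card sE) eqn_add2r eqn_pmul2l // => /eqP->.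
Qed.

Lemma facet_with_zero E : 0 < n -> reflect (saturated setT E) (facet (with_zero E)).
Proof.
move=> n0; apply: (iffP (facetP _ n0)) => [[F sF /with_zero_inj -> //]|sE].
by exists E.
Qed.

(** Counting is done on arc sets; as [saturated] is not boolean, [facet (with_zero E)] stands for
    it. *)
Lemma num_facetsE : 0 < n -> num_facets n = #|[set E | facet (with_zero E)]|.
Proof.
move=> n0; rewrite -(card_imset _ with_zero_inj); apply: eq_card => X.
rewrite inE; apply/idP/imsetP => [fX|[E + ->]]; last by rewrite inE.
have /facetP[//|E sE XE] := fX; exists E => //; by rewrite inE -XE.
Qed.

End Faces.

(** * Trees and Pruefer codes *)

Section Trees.

Variable T : finType.
Implicit Types (A B V W : {set T}) (D E : {set T * T}) (x y u v w a b : T) (p q : seq T).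

(** An undirected tree is a symmetric set of arcs. Trees grow by joining two of them with an edge,
    in parallel with the splittings of [saturated]. *)
Inductive tree : {set T} -> {set T * T} -> Prop :=
| tree1 v : tree [set v] set0
| treeU A B D D' a b :
    [disjoint A & B] -> a \in A -> b \in B -> tree A D -> tree B D' ->
    tree (A :|: B) (D :|: D' :|: [set (a, b); (b, a)]).

Definition nbr D x : {set T} := [set y | (x, y) \in D].

Definition del D v : {set T * T} := [set e in D | (e.1 != v) && (e.2 != v)].

Lemma tree_in V D x y : tree V D -> (x, y) \in D -> (x \in V) && (y \in V).
Proof.
move=> tD; elim: tD x y => [v|A B {}D D' a b _ aA bB _ hD _ hD'] x y; rewrite !inE //.
case/orP => [/orP[/hD|/hD']/andP[-> ->]|]; rewrite ?orbT //.
by case/orP => /eqP[-> ->]; rewrite aA bB !orbT.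
Qed.

Lemma tree_sym V D x y : tree V D -> (x, y) \in D -> (y, x) \in D.
Proof.
move=> tD; elim: tD x y => [v|A B {}D D' a b _ aA bB _ hD _ hD'] x y; rewrite !inE //.
case/orP => [/orP[/hD|/hD']->|]; rewrite ?orbT //.
by case/orP => /eqP[-> ->]; rewrite eqxx !orbT.
Qed.

Lemma tree_irr V D x y : tree V D -> (x, y) \in D -> x != y.
Proof.
move=> tD; elim: tD x y => [v|A B {}D D' a b dAB aA bB _ hD _ hD'] x y; rewrite !inE //.
case/orP => [/orP[/hD|/hD']//|].
have ab : a != b by apply: contraTneq bB => <-; rewrite (disjointFr dAB aA).
by case/orP => /eqP[-> ->]; rewrite // eq_sym.
Qed.

Lemma nbr_treeU A B D D' a b x :
    [disjoint A & B] -> b \in B -> tree B D' -> x \in A ->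
  nbr (D :|: D' :|: [set (a, b); (b, a)]) x =
    nbr D x :|: (if x == a then [set b] else set0).
Proof.
move=> dAB bB tD' xA; have xB := disjointFr dAB xA.
have xb : x == b = false by apply/eqP => xb; rewrite xb bB in xB.
apply/setP => y; rewrite !inE !xpair_eqE xb /= orbF.
have -> : (x, y) \in D' = false.
  by apply/negP => /(tree_in tD'); rewrite xB.
by rewrite orbF; case: (x == a); rewrite !inE.
Qed.

(** This symmetry lets the arguments below treat only the vertices of the first subtree. *)
Lemma treeUC D D' a b :
  D :|: D' :|: [set (a, b); (b, a)] = D' :|: D :|: [set (b, a); (a, b)].
Proof. by rewrite (setUC D) (setUC [set (a, b)]). Qed.

Lemma nbr_tree V D x : tree V D -> 1 < #|V| -> x \in V -> 0 < #|nbr D x|.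
Proof.
have aux A B D1 D' a b y : [disjoint A & B] -> a \in A -> b \in B -> tree B D' ->
    (1 < #|A| -> y \in A -> 0 < #|nbr D1 y|) -> y \in A ->
    0 < #|nbr (D1 :|: D' :|: [set (a, b); (b, a)]) y|.
  move=> dAB aA bB tD' IH yA; rewrite (nbr_treeU _ _ dAB bB tD' yA).
  have [A1|A1] := leqP #|A| 1; last first.
    by apply: leq_trans (IH A1 yA) _; apply: subset_leq_card; apply: subsetUl.
  rewrite (card_le1_eqP A1 y a) // eqxx.
  by apply/card_gt0P; exists b; rewrite !inE eqxx orbT.
move=> tD; elim: tD x => [v|A B {}D D' a b dAB aA bB tD IHD tD' IHD'] x.
  by rewrite cards1.
move=> _; rewrite inE => /orP[xA|xB]; first by apply: aux dAB _ _ _ _ _ => //; apply: IHD.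
rewrite treeUC; rewrite disjoint_sym in dAB.
by apply: aux dAB _ _ _ _ _ => //; apply: IHD'.
Qed.

(** Avoiding a prescribed [w] makes the induction work: the leaf is found in the part without [w],
    avoiding there the end of the joining edge. If that part is a single vertex, this vertex is the
    leaf. *)
Lemma tree_leaf V D w :
  tree V D -> 1 < #|V| -> w \in V -> exists v, [/\ v \in V, v != w & #|nbr D v| = 1].
Proof.
have aux A B D1 D' a b : [disjoint A & B] -> a \in A -> b \in B -> tree A D1 -> tree B D' ->
    (1 < #|A| -> exists v, [/\ v \in A, v != a & #|nbr D1 v| = 1]) ->
    exists2 v, v \in A & #|nbr (D1 :|: D' :|: [set (a, b); (b, a)]) v| = 1.
  move=> dAB aA bB tD1 tD' IH; have [A1|A1] := leqP #|A| 1; last first.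
    have [v [vA va nv]] := IH A1; exists v => //.
    by rewrite (nbr_treeU _ _ dAB bB tD' vA) (negPf va) setU0.
  exists a => //; rewrite (nbr_treeU _ _ dAB bB tD' aA) eqxx.
  have -> : nbr D1 a = set0; last by rewrite set0U cards1.
  apply/setP => y; rewrite !inE; apply/negP => ayD.
  have /andP[_ yA] := tree_in tD1 ayD.
  by have := tree_irr tD1 ayD; rewrite (card_le1_eqP A1 a y) ?eqxx.
move=> tD; elim: tD w => [v|A B {}D D' a b dAB aA bB tD IHD tD' IHD'] w.
  by rewrite cards1.
have dBA : [disjoint B & A] by rewrite disjoint_sym.
move=> _; rewrite inE => /orP[wA|wB].
  rewrite treeUC.
  have [|v vB nv] := aux B A D' D b a dBA bB aA tD' tD.
    by move=> B1; apply: IHD'.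
  exists v; split=> //; first by rewrite inE vB orbT.
  by apply: contraTneq vB => ->; rewrite (disjointFr dAB wA).
have [|v vA nv] := aux A B D D' a b dAB aA bB tD tD'.
  by move=> A1; apply: IHD.
exists v; split=> //; first by rewrite inE vA.
by apply: contraTneq vA => ->; rewrite (disjointFr dBA wB).
Qed.

Lemma tree_del V D v :
  tree V D -> 1 < #|V| -> v \in V -> #|nbr D v| = 1 -> tree (V :\ v) (del D v).
Proof.
have delE A B D1 D' a b u : [disjoint A & B] -> tree B D' -> u \in A -> b \in B ->
    del (D1 :|: D' :|: [set (a, b); (b, a)]) u =
      del D1 u :|: D' :|: (if a == u then set0 else [set (a, b); (b, a)]).
  move=> dAB tD' uA bB; have uB := disjointFr dAB uA.
  have ub : b == u = false by apply/eqP => ub; rewrite -ub bB in uB.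
  apply/setP => -[x y]; rewrite !inE /= !andb_orl; congr (_ || _ || _).
    case xyD : (_ \in D') => //=; have /andP[xB yB] := tree_in tD' xyD.
    by apply/andP; split; [apply: contraTneq xB | apply: contraTneq yB] => ->; rewrite uB.
  rewrite -andb_orl; case: ifP => au; rewrite !inE; last first.
    by apply: andb_idr => /orP[] /eqP[-> ->]; rewrite au ub.
  by apply/negP => /andP[/orP[] /eqP[-> ->]]; rewrite au ?andbF.
have aux A B D1 D' a b u : [disjoint A & B] -> a \in A -> b \in B -> tree A D1 -> tree B D' ->
    (1 < #|A| -> u \in A -> #|nbr D1 u| = 1 -> tree (A :\ u) (del D1 u)) -> u \in A ->
    let D0 := D1 :|: D' :|: [set (a, b); (b, a)] in
    #|nbr D0 u| = 1 -> tree ((A :|: B) :\ u) (del D0 u).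
  move=> dAB aA bB tD1 tD' IH uA /=; rewrite (delE A B) // (nbr_treeU _ _ dAB bB tD' uA).
  have VE : (A :|: B) :\ u = A :\ u :|: B.
    apply/setP => x; rewrite !inE; case: eqP => //= ->.
    by rewrite (disjointFr dAB uA).
  (* If [A] is the leaf alone, the other subtree remains. *)
  rewrite VE; have [A1|A1] := leqP #|A| 1.
    have au : a = u by apply: (card_le1_eqP A1).
    rewrite au eqxx setU0 => _.
    have -> : A :\ u = set0.
      apply/setP => x; rewrite !inE; apply/andP => -[xu xA].
      by rewrite (card_le1_eqP A1 x u) ?eqxx in xu.
    have -> : del D1 u = set0; last by rewrite !set0U.
    apply/setP => -[x y]; rewrite !inE /=; apply/and3P => -[/(tree_in tD1)/andP[xA _]].
    by rewrite (card_le1_eqP A1 x u) // eqxx.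
  (* The vertex [a] has a neighbour in [A] besides [b], so it is not a leaf. *)
  have [ua|nau] := eqVneq u a.
    rewrite ua => card1; have := nbr_tree tD1 A1 aA; have := card1.
    rewrite cardsU cards1; have -> : nbr D1 a :&: [set b] = set0.
      apply/setP => y; rewrite !inE; apply/negP => /andP[/(tree_in tD1)/andP[_ yA] /eqP yb].
      by rewrite yb (disjointFl dAB bB) in yA.
    rewrite cards0 subn0 addn1; by case=> ->.
  rewrite setU0 => /(IH A1 uA) tA; apply: treeU => //.
  - by apply: disjointWl dAB; apply: subD1set.
  - by rewrite !inE eq_sym nau.
move=> tD; elim: tD v => [w|A B {}D D' a b dAB aA bB tD IHD tD' IHD'] v.
  by rewrite cards1.
move=> _; rewrite inE => /orP[vA|vB]; first exact: aux (IHD v) _.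
rewrite treeUC (setUC A); apply: aux (IHD' v) _ => //.
by rewrite disjoint_sym.
Qed.

End Trees.

(** * Pruefer codes, and the order and tree of a saturated set *)

Section Prufer.

Variable T : finType.
Implicit Types (A B V W : {set T}) (D E : {set T * T}) (x y u v w a b : T) (p q : seq T).

(* Any fixed choice of a leaf serves instead of the least one; on the empty
   code, V is meant to have two elements. *)
Fixpoint prufer V p : {set T * T} :=
  if p is u :: p' then
    if [pick v in V | v \notin p] is Some v
    then [set (u, v); (v, u)] :|: prufer (V :\ v) p' else set0
  else [set e | [&& e.1 \in V, e.2 \in V & e.1 != e.2]].

(** The length is [#|V| - 2]; in this form the condition also forces [V] to have at least two
    elements. *)
Definition prufer_code V p : bool := ((size p).+2 == #|V|) && all (mem V) p.

(** A code is shorter than [V] is large, so some vertex is missing from it; removing that vertex and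
    the first letter leaves a code. *)
Lemma prufer_code_pick V u p : prufer_code V (u :: p) ->
  exists v, [/\ [pick v in V | v \notin u :: p] = Some v, v \in V,
    v \notin u :: p, u \in V :\ v & prufer_code (V :\ v) p].
Proof.
case/andP => /eqP sV /= /andP[uV pV].
case: pickP => [v /andP[vV vp]|none].
  exists v; split=> //; move: vp; rewrite inE negb_or => /andP[vu vp].
    by rewrite !inE eq_sym vu.
  move: sV; rewrite /= (cardsD1 v) vV add1n => -[sV]; rewrite /prufer_code sV eqxx /=.
  apply/allP => x xp; have /= xV := allP pV _ xp; rewrite /= !inE xV andbT.
  by apply: contraNneq vp => <-.
have : #|V| <= #|u :: p|.
  apply: subset_leq_card; apply/subsetP => x xV.
  by have := none x; rewrite xV /= => /negbFE.
move/leq_trans/(_ (card_size _)); rewrite -sV /= ; by rewrite ltnNge leqnSn.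
Qed.

Lemma prufer_in V p x y : prufer_code V p -> (x, y) \in prufer V p ->
  [&& x \in V, y \in V, x != y & (y, x) \in prufer V p].
Proof.
elim: p V => [|u p IHp] V cV.
  by rewrite !inE /= => /and3P[-> -> nxy]; rewrite [y == x]eq_sym nxy.
have [v [pv vV vp uW cW]] := prufer_code_pick cV; rewrite [prufer _ _]/= pv.
have [uv uV] := setD1P uW.
rewrite in_setU => /orP[|/(IHp _ cW)/and4P[xW yW xy yx]].
  by rewrite !inE => /orP[] /eqP[-> ->]; rewrite vV uV eqxx ?orbT andbT // eq_sym.
case/setD1P: xW => _ xV; case/setD1P: yW => _ yV.
by rewrite xV yV xy in_setU yx orbT.
Qed.

Lemma nbr_prufer_cons V D u v x : u != v ->
    (forall y, ((v, y) \in D) = false) ->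
  nbr ([set (u, v); (v, u)] :|: D) x =
    if x == v then [set u] else nbr D x :|: (if x == u then [set v] else set0).
Proof.
move=> uv Dv; apply/setP => y; rewrite !inE !xpair_eqE.
have [->|xv] := eqVneq x v; first by rewrite eq_sym (negPf uv) Dv !inE orbF.
by case: (x == u); rewrite /= !inE ?orbF // orbC.
Qed.

(** Attaching [v] to [u] raises the degree of [u] by one, as the letter [u] does its count; [v] has
    degree one and does not occur. Hence the leaves are the vertices missing from the code. *)
Lemma card_nbr_prufer V p x :
  prufer_code V p -> x \in V -> #|nbr (prufer V p) x| = (count_mem x p).+1.
Proof.
elim: p V => [|u p IHp] V cV xV.
  have -> : nbr (prufer V [::]) x = V :\ x.
    by apply/setP => y; rewrite !inE xV /= eq_sym andbC.
  by case/andP: cV => /eqP; rewrite (cardsD1 x V) xV add1n => -[<-] _.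
have [v [pv vV vp uW cW]] := prufer_code_pick cV; rewrite [prufer _ _]/= pv.
have [uv uV] := setD1P uW.
have vW y : ((v, y) \in prufer (V :\ v) p) = false.
  by apply/negP => /(prufer_in cW)/and4P[]; rewrite !inE eqxx.
rewrite nbr_prufer_cons //; case: (eqVneq x v) => [->|xv].
  by rewrite cards1; have /count_memPn -> := vp.
have xW : x \in V :\ v by rewrite !inE xv.
rewrite cardsU (IHp _ cW xW) /= [u == x]eq_sym; case: eqP => [->|_].
  have -> : nbr (prufer (V :\ v) p) u :&: [set v] = set0.
    apply/setP => y; rewrite !inE; apply/negP => /andP[/[swap]/eqP->].
    by move/(prufer_in cW)/and4P => -[_]; rewrite !inE eqxx.
  by rewrite cards0 cards1 subn0 addn1.
by rewrite setI0 cards0 subn0 addn0.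
Qed.

Lemma notin_prufer_code V p x :
  prufer_code V p -> x \in V -> (x \notin p) = (#|nbr (prufer V p) x| == 1).
Proof. by move=> cV xV; rewrite card_nbr_prufer // eqSS -has_pred1 has_count -eqn0Ngt. Qed.

(** The tree determines its leaves, hence the chosen leaf [v]; the only neighbour of [v] is the
    first letter, and the rest of the tree gives the rest of the code. *)
Lemma prufer_inj V p q :
  prufer_code V p -> prufer_code V q -> prufer V p = prufer V q -> p = q.
Proof.
elim: p V q => [|u p IHp] V [|u' q] //.
- by rewrite /prufer_code; case/andP => /eqP <- _ /andP[].
- by rewrite /prufer_code; move=> /andP[/eqP h _] /andP[/eqP]; rewrite -h.
move=> cp cq eqD; have [v [pv vV vp uW cW]] := prufer_code_pick cp.
have [v' [pv' vV' vp' uW' cW']] := prufer_code_pick cq.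
have eqv : v = v'.
  apply: Some_inj; rewrite -pv -pv'; apply: eq_pick => x /=.
  by case xV: (x \in V); rewrite //= (notin_prufer_code cp xV) (notin_prufer_code cq xV) eqD.
rewrite -{v' vV' vp' pv'}eqv in uW' cW' pv' *.
move: eqD; rewrite [prufer _ _]/= pv [prufer V (u' :: q)]/= pv' => eqD.
have [uv uV] := setD1P uW; have [uv' uV'] := setD1P uW'.
have vW r y : prufer_code (V :\ v) r -> ((v, y) \in prufer (V :\ v) r) = false.
  by move=> c; apply/negP => /(prufer_in c)/and4P[]; rewrite !inE eqxx.
have vW' r y : prufer_code (V :\ v) r -> ((y, v) \in prufer (V :\ v) r) = false.
  by move=> c; apply/negP => /(prufer_in c)/and4P[_]; rewrite !inE eqxx.
have uu : u = u'.
  have := congr1 (fun D => nbr D v) eqD; rewrite /= !nbr_prufer_cons // ?eqxx.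
  - exact: set1_inj.
  - by move=> y; apply: vW.
  - by move=> y; apply: vW.
congr (_ :: _) => //; apply: (IHp _ _ cW cW'); apply/setP => -[x y].
have [->|xv] := eqVneq x v; first by rewrite !vW.
have [->|yv] := eqVneq y v; first by rewrite !vW'.
have /setP/(_ (x, y)) := eqD; rewrite !inE !xpair_eqE (negPf xv) (negPf yv) /=.
by rewrite !andbF.
Qed.

Lemma tree_prufer V D : tree V D -> 1 < #|V| -> exists2 p, prufer_code V p & D = prufer V p.
Proof.
have [m] := ubnP #|V|; elim: m => // m IHm in V D *; rewrite ltnS => leVm tD V1.
have symD x y : (x, y) \in D = ((y, x) \in D).
  by apply/idP/idP; apply: tree_sym tD.
have [V2|V2] := leqP #|V| 2.
  exists [::]; first by rewrite /prufer_code /= eq_sym eqn_leq V2 V1.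
  apply/setP => -[x y]; rewrite inE /=.
  apply/idP/and3P => [xyD|[xV yV xy]].
    by have /andP[-> ->] := tree_in tD xyD; rewrite (tree_irr tD xyD).
  have : 0 < #|nbr D x| by apply: nbr_tree tD V1 xV.
  case/card_gt0P => z; rewrite inE => xzD.
  have /andP[_ zV] := tree_in tD xzD; have xz := tree_irr tD xzD.
  case: (eqVneq y z) => [-> //|yz].
  have : #|[set x; y; z]| <= 2.
    apply: leq_trans V2; apply: subset_leq_card.
    by apply/subsetP => t; rewrite !inE => /orP[/orP[]|] /eqP->.
  by rewrite -setUA cardsU1 !inE negb_or xy xz cards2 yz.
have [w wV] : exists w, w \in V by apply/card_gt0P; lia.
have [v0 [v0V _ nv0]] := tree_leaf tD V1 wV.
(* The leaf must be the one that [prufer] will choose, so it is picked by a predicate that later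
   turns out to agree with absence from the code. *)
pose leaf v := (v \in V) && (#|nbr D v| == 1).
have [v pv] : exists v, [pick v | leaf v] = Some v.
  case: pickP => [v _|/(_ v0)]; first by exists v.
  by rewrite /leaf v0V nv0.
have /andP[vV /eqP nv] : leaf v by move: pv; case: pickP => // x lx [<-].
have [u nu] : exists u, nbr D v = [set u] by apply/cards1P/eqP.
have vuD : (v, u) \in D by have := set11 u; rewrite -nu inE.
have uv : u != v by rewrite eq_sym; apply: tree_irr tD vuD.
have /andP[_ uV] := tree_in tD vuD.
have cV : #|V| = #|V :\ v|.+1 by rewrite (cardsD1 v) vV.
have [||p cp Dp] := IHm _ _ _ (tree_del tD V1 vV nv); try by rewrite -ltnS -cV.
have DE : D = [set (u, v); (v, u)] :|: prufer (V :\ v) p.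
  rewrite -Dp; apply/setP => -[x y]; rewrite !inE !xpair_eqE /=.
  have vD z : (v, z) \in D = (z == u) by have /setP/(_ z) := nu; rewrite !inE.
  have [->|xv] := eqVneq x v.
    by rewrite vD [v == u]eq_sym (negPf uv) /= andbF orbF.
  have [->|yv] := eqVneq y v; last by rewrite !andbF /= andbT.
  by rewrite symD vD !andbF !andbT !orbF.
have cup : prufer_code V (u :: p).
  case/andP: cp => /eqP sp /allP ap; apply/andP; split; first by rewrite cV /= -sp.
  apply/allP => x; rewrite inE => /orP[/eqP-> //|/ap].
  by rewrite /= inE => /andP[].
exists (u :: p); rewrite //= (_ : [pick v in V | _] = Some v) // -pv.
apply: eq_pick => x /=; rewrite /leaf; case xV: (x \in V) => //=.
rewrite DE nbr_prufer_cons //; last first.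
  by move=> y; apply/negP => /(prufer_in cp)/and4P[]; rewrite !inE eqxx.
have vp : v \notin p.
  by apply/negP => vp; case/andP: cp => _ /allP/(_ _ vp); rewrite /= !inE eqxx.
rewrite inE negb_or; have [->|xv] := eqVneq x v; first by rewrite eq_sym uv vp cards1.
have xW : x \in V :\ v by rewrite !inE xv.
have [->|xu /=] := eqVneq x u; last by rewrite setU0 (notin_prufer_code cp xW).
rewrite /= cardsU; have -> : nbr (prufer (V :\ v) p) u :&: [set v] = set0.
  apply/setP => y; rewrite !inE; apply/negP => /andP[/[swap]/eqP->].
  by move/(prufer_in cp)/and4P => -[_]; rewrite !inE eqxx.
rewrite cards0 cards1 subn0 addn1 card_nbr_prufer //.
by rewrite !inE uv.
Qed.

(** The order puts [B] before [A], so the arcs from [B] to [A] go forward, and the splitting arcs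
    [(a, b)] become the tree edges. Ranks below [#|V|] yield a permutation when [V] is
    everything. *)
Lemma saturated_rank V E : saturated V E ->
  exists (r : T -> nat) D,
    [/\ tree V D, forall x, x \in V -> r x < #|V|, {in V &, injective r}
      & E = [set e in setX V V | (r e.1 <= r e.2) || (e \in D)]].
Proof.
elim=> [v|A B {}E F a b dAB aA bB sE [r [D [tD rA injr EE]]] sF [r' [D' [tD' rB injr' FE]]]].
  exists (fun=> 0), set0; split=> [|x _||]; rewrite ?cards1 //; first exact: tree1.
    by move=> x y /set1P-> /set1P->.
  by apply/setP => -[x y]; rewrite !inE /= andbT.
have dBA x : x \in B -> (x \in A) = false by move=> xB; apply: (disjointFl dAB).
have dAB' x (xA : x \in A) := disjointFr dAB xA.
have card : #|A :|: B| = #|A| + #|B|.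
  by rewrite cardsU (disjoint_setI0 dAB) cards0 subn0.
exists (fun x => if x \in A then #|B| + r x else r' x), (D :|: D' :|: [set (a, b); (b, a)]).
split.
- exact: treeU.
- move=> x; rewrite card inE; case: ifP => [xA _|_ /= xB].
    by rewrite addnC ltn_add2r rA.
  by apply: ltn_addl; apply: rB.
- move=> x y; rewrite !inE; case: ifP => [xA _|_ /= xB]; case: ifP => [yA _|_ /= yB].
  + by move/addnI; apply: injr.
  + by move=> h; have := rB _ yB; rewrite -h ltnNge leq_addr.
  + by move=> h; have := rB _ xB; rewrite h ltnNge leq_addr.
  + exact: injr'.
apply/setP => -[x y].
have inD z t : (z, t) \in D -> (z \in A) && (t \in A) by apply: tree_in tD.
have inD' z t : (z, t) \in D' -> (z \in B) && (t \in B) by apply: tree_in tD'.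
rewrite EE FE !inE /= !xpair_eqE.
have [xA|xA] := boolP (x \in A); have [yA|yA] := boolP (y \in A); rewrite /=.
- rewrite (dAB' _ xA) (dAB' _ yA) /= leq_add2l !orbF.
  have -> : (x, y) \in D' = false by apply/negP => /inD'; rewrite dAB'.
  have -> : y == b = false by apply/eqP => yb; rewrite yb dBA in yA.
  have -> : x == b = false by apply/eqP => xb; rewrite xb dBA in xA.
  by rewrite andbF !orbF.
(* From [A] to [B] no arc agrees with the order; only the tree edge [(a, b)] remains. *)
- rewrite (dAB' _ xA) /= !orbF.
  have [yB|yB] /= := boolP (y \in B); last first.
    by rewrite andbC; case: eqP => // yb; rewrite yb bB in yB.
  have -> : #|B| + r x <= r' y = false.
    by apply/negP => h; have := leq_trans (rB _ yB) (leq_trans (leq_addr _ _) h); rewrite ltnn.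
  have -> : (x, y) \in D' = false by apply/negP => /inD'; rewrite dAB'.
  have -> : (x, y) \in D = false by apply/negP => /inD; rewrite (negPf yA) andbF.
  have -> : x == b = false by apply/eqP => xb; rewrite xb dBA in xA.
  by rewrite /= orbF.
- have -> : x == a = false by apply/eqP => xa; rewrite xa aA in xA.
  rewrite (dAB' _ yA) /= andbF /= andbT.
  have [xB|//] /= := boolP (x \in B).
  by rewrite (leq_trans (ltnW (rB _ xB)) (leq_addr _ _)).
- have -> : x == a = false by apply/eqP => xa; rewrite xa aA in xA.
  have -> : y == a = false by apply/eqP => ya; rewrite ya aA in yA.
  have -> : (x, y) \in D = false by apply/negP => /inD; rewrite (negPf xA).
  by rewrite !andbF !orbF.
Qed.

End Prufer.

(** * Upper bound *)

Section UpperBound.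

Variable n : nat.
Hypothesis n_ge2 : 2 <= n.

Local Notation word := ((n - 2).-tuple 'I_n).

Lemma prufer_code_word (p : word) : prufer_code setT p.
Proof.
rewrite /prufer_code size_tuple cardsT card_ord -addn2 subnK // eqxx /=.
by apply/allP => x _; rewrite /= inE.
Qed.

Definition decode (sp : {perm 'I_n} * word) : {set 'I_n * 'I_n} :=
  [set e | (sp.1 e.1 <= sp.1 e.2) || (e \in prufer setT sp.2)].

Lemma saturated_decode E : saturated setT E -> exists sp, E = decode sp.
Proof.
case/saturated_rank => r [D [tD ltr injr ->]].
have [|p cp ->] := tree_prufer tD; first by rewrite cardsT card_ord.
have ltr' x : r x < n by have := ltr x (in_setT x); rewrite cardsT card_ord.
have injr' : injective (fun x => Ordinal (ltr' x)).
  by move=> x y [] /injr; apply; rewrite inE.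
have sp : size p == n - 2.
  by case/andP: cp => /eqP + _; rewrite cardsT card_ord => sz; apply/eqP; lia.
exists (perm injr', Tuple sp); apply/setP => -[x y].
by rewrite !inE /= !permE.
Qed.

(* Exchanging the two smallest vertices of the order does not change the
   decoded set when they are joined by an edge of the tree. *)
Lemma decode_not_inj : ~~ injectiveb decode.
Proof.
have n0 : 0 < n by apply: leq_trans n_ge2.
pose i0 := Ordinal n0; pose i1 := Ordinal n_ge2.
(* Any code would do; what matters is a tree edge between [i0] and some [y]. *)
pose p : word := nseq_tuple _ i0.
have : 0 < #|nbr (prufer setT p) i0| by rewrite card_nbr_prufer ?prufer_code_word.
case/card_gt0P => y; rewrite inE => i0y.
have /and4P[_ _ ne yi0] := prufer_in (prufer_code_word p) i0y.
(* [s] ranks [i0] and [y] as 0 and 1, and [s'] exchanges these two ranks. *)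
pose s : {perm 'I_n} := tperm y i1.
have s0 : s i0 = i0 by rewrite tpermD // eq_sym.
have s1 : s y = i1 by rewrite tpermL.
pose s' : {perm 'I_n} := (tperm i0 y * s)%g.
apply/injectiveP => /(_ (s, p) (s', p)) inj.
have : s = s'.
  suff /inj[] : decode (s, p) = decode (s', p) by [].
  apply/setP => -[x z]; rewrite !inE /=.
  case xz: (_ \in prufer _ _); first by rewrite !orbT.
  rewrite !orbF /s' !permM.
  have big t : t != i0 -> t != y -> 1 < s t.
    move=> t0 ty; have s_0 : s t != i0 by rewrite -s0 (inj_eq perm_inj).
    have s_1 : s t != i1 by rewrite -s1 (inj_eq perm_inj).
    by rewrite -!val_eqE /= in s_0 s_1; lia.
  case: (tpermP i0 y x) => [xE|xE|/eqP x0 /eqP xy];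
    case: (tpermP i0 y z) => [zE|zE|/eqP z0 /eqP zy] //; subst.
  - by rewrite !leqnn.
  - by rewrite i0y in xz.
  - by have := big _ z0 zy; rewrite s0 s1 /= => /ltnW ->.
  - by rewrite yi0 in xz.
  - by rewrite !leqnn.
  - by have := big _ z0 zy; rewrite s0 s1 /= => /ltnW ->.
  - by have := big _ x0 xy; rewrite s0 s1 /=; case: (s x : nat) => [|[]].
  - by have := big _ x0 xy; rewrite s0 s1 /=; case: (s x : nat) => [|[]].
move/permP/(_ i0); rewrite permM tpermL s0 s1 => /(congr1 val).
by [].
Qed.

(** The facets lie in the image of [decode], which is smaller than its domain because [decode] is
    not injective. *)
Lemma num_facets_lt : num_facets n < n`! * n ^ (n - 2).
Proof.
have n0 : 0 < n by apply: leq_trans n_ge2.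
have -> : n`! * n ^ (n - 2) = #|{: {perm 'I_n} * word}|.
  by rewrite card_prod card_tuple card_Sn card_ord.
apply: (@leq_ltn_trans #|decode @: setT|).
  rewrite num_facetsE //; apply: subset_leq_card; apply/subsetP => E.
  by rewrite inE => /(facet_with_zero _ n0)/saturated_decode[sp ->]; apply: imset_f.
rewrite ltn_neqAle -cardsT leq_imset_card andbT.
apply: contra decode_not_inj => /imset_injP inj.
by apply/injectiveP => x y; apply: inj; rewrite inE.
Qed.

End UpperBound.

(** * Lower bound *)

Section Directed.

Variable T : finType.
Implicit Types (A B V W : {set T}) (D E : {set T * T}) (x y u v w a b : T) (p q : seq T)
  (d e : seq bool).

(* The vertex v removed by the Pruefer code is placed last (true) or first
   (false) in the order of the remaining vertices. *)
Fixpoint encode V p d : {set T * T} :=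
  match p, d with
  | u :: p', t :: d' =>
    if [pick v in V | v \notin p] is Some v then
      [set e in setX V V |
        if e.1 == v then [|| e.2 == v, e.2 == u | ~~ t]
        else if e.2 == v then (e.1 == u) || t
        else e \in encode (V :\ v) p' d']
    else set0
  | _, _ => setX V V
  end.

Lemma saturated_encode V p d :
  prufer_code V p -> size d = size p -> saturated V (encode V p d).
Proof.
elim: p V d => [|u p IHp] V [|t d] //.
  case/andP=> /= /[1!eq_sym] /cards2P[x [y [xy ->]]] _ _.
  have -> : setX [set x; y] [set x; y] =
      (x, y) |: ([set (x, x)] :|: [set (y, y)] :|: setX [set y] [set x]).
    apply/setP => -[z w]; rewrite !inE !xpair_eqE.
    by do 4 case: (_ == _).
  apply: saturatedU; rewrite ?set11 //; try exact: saturated1.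
  by rewrite disjoints1 inE.
move=> cV [sd]; have [v [pv vV vp uW cW]] := prufer_code_pick cV; rewrite [encode _ _ _]/= pv.
have sW := IHp _ _ cW sd; set E := encode _ _ _ in sW *.
have [uv uV] := setD1P uW.
have EW x y := @saturated_in _ (V :\ v) E x y sW.
have dis : [disjoint [set v] & V :\ v] by rewrite disjoints1 !inE eqxx.
have Ev y : (v, y) \in E = false by apply/negP => /EW; rewrite !inE eqxx.
have Ev' y : (y, v) \in E = false by apply/negP => /EW; rewrite !inE eqxx andbF.
have VE : V = [set v] :|: V :\ v by rewrite setD1K.
case: t {cV}.
  (* With [v] last, [[set v]] is the side [A] of the splitting and [(v, u)] its only outgoing arc;
     with [v] first, it is the side [B], entered by [(u, v)] only. *)
  rewrite [X in saturated X _]VE.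
  have -> : [set e in setX V V | if e.1 == v then [|| e.2 == v, e.2 == u | ~~ true]
        else if e.2 == v then (e.1 == u) || true else e \in E] =
     (v, u) |: ([set (v, v)] :|: E :|: setX (V :\ v) [set v]).
    apply/setP => -[x y]; rewrite !inE !xpair_eqE /= orbF.
    have [->|xv] := eqVneq x v; have [->|yv] := eqVneq y v;
      rewrite /= ?vV ?Ev ?Ev' ?orbT ?andbT ?orbF //=.
    - by rewrite andbC; case: eqP => // ->; rewrite uV.
    - by rewrite andbF orbF; apply: andb_idl => /EW; rewrite !inE => /andP[/andP[_ ->] /andP[_ ->]].
  by apply: saturatedU; rewrite ?set11 //; exact: saturated1.
rewrite [X in saturated X _]VE setUC.
have -> : [set e in setX V V | if e.1 == v then [|| e.2 == v, e.2 == u | ~~ false]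
        else if e.2 == v then (e.1 == u) || false else e \in E] =
     (u, v) |: (E :|: [set (v, v)] :|: setX [set v] (V :\ v)).
  apply/setP => -[x y]; rewrite !inE !xpair_eqE /= !orbT.
  have [->|xv] := eqVneq x v; have [->|yv] := eqVneq y v;
      rewrite /= ?vV ?Ev ?Ev' ?orbT ?andbT ?orbF ?andbF //=.
  - by rewrite andbC; case: eqP => // ->; rewrite uV.
  - by apply: andb_idl => /EW; rewrite !inE => /andP[/andP[_ ->] /andP[_ ->]].
by apply: saturatedU; rewrite ?set11 1?disjoint_sym //; exact: saturated1.
Qed.

(** On a saturated set this is the spanning tree. *)
Definition two_way E : {set T * T} :=
  [set e in E | (e.1 != e.2) && ((e.2, e.1) \in E)].

Lemma two_way_encode V p d :
  prufer_code V p -> size d = size p -> two_way (encode V p d) = prufer V p.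
Proof.
elim: p V d => [|u p IHp] V [|t d] //.
  move=> _ _; apply/setP => -[x y]; rewrite !inE /= -andbA.
  by do 3 case: (_ \in _) || case: (_ == _).
move=> cV [sd]; have [v [pv vV vp uW cW]] := prufer_code_pick cV.
rewrite [encode _ _ _]/= [prufer _ _]/= pv -(IHp _ _ cW sd).
have sW := saturated_encode cW sd; set E := encode _ _ _ in sW *.
have EW x y := @saturated_in _ (V :\ v) E x y sW.
have Ev y : (v, y) \in E = false by apply/negP => /EW; rewrite !inE eqxx.
have Ev' y : (y, v) \in E = false by apply/negP => /EW; rewrite !inE eqxx andbF.
have [uv uV] := setD1P uW.
apply/setP => -[x y]; rewrite !inE !xpair_eqE /=.
have [->|xv] := eqVneq x v; have [->|yv] := eqVneq y v.
- by rewrite /= andbF [v == u]eq_sym (negPf uv) Ev.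
- rewrite Ev [v == u]eq_sym (negPf uv) vV /= orbF andbT.
  case: eqP => [->|_] /=; first by rewrite uV.
  by case: (t); rewrite ?andbF.
- rewrite Ev' [v == u]eq_sym (negPf uv) vV xv !andbF !andbT /= !orbF.
  case: eqP => [->|_] /=; first by rewrite uV.
  by case: (t); rewrite ?andbF.
rewrite !andbF /=; apply/idP/idP.
  by case/andP=> /andP[_ ->] /andP[-> /andP[_ ->]].
case/andP=> xy /andP[-> yx]; rewrite xy yx.
by have := EW _ _ xy; rewrite !inE => /andP[/andP[_ ->] /andP[_ ->]].
Qed.

(** The two-way arcs give back the tree and hence the code; each bit is then read off an arc between
    the removed leaf and a vertex other than its neighbour. *)
Lemma encode_inj V p q d e :
  prufer_code V p -> prufer_code V q -> size d = size p -> size e = size q ->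
  encode V p d = encode V q e -> p = q /\ d = e.
Proof.
move=> cp cq sd se EE.
have pq : p = q.
  by apply: (prufer_inj cp cq); rewrite -(two_way_encode cp sd) EE two_way_encode.
split=> //; rewrite -{q cq}pq in se EE.
elim: p V d e sd se cp EE => [|u p IHp] V [|t d] [|s e] //.
move=> [sd] [se] cV; have [v [pv vV vp uW cW]] := prufer_code_pick cV.
rewrite [encode _ _ _]/= [encode _ _ (s :: e)]/= pv => EE.
have [uv uV] := setD1P uW.
(* The code is not empty, so [V] has a third vertex [w]; the arc [(v, w)] is present exactly when
   [v] is placed first. *)
have [w [wV wv wu]] : exists w, [/\ w \in V, w != v & w != u].
  have : 0 < #|V :\ v :\ u|.
    have := cardsD1 u (V :\ v); rewrite uW.
    by case/andP: cW => /eqP <- _; rewrite add1n => -[<-].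
  by case/card_gt0P => w; rewrite !inE => /and3P[wu wv wV]; exists w.
have ts : t = s.
  have /setP/(_ (v, w)) := EE; rewrite !inE /= eqxx vV wV (negPf wv) (negPf wu) /=.
  exact: negb_inj.
rewrite ts; congr (_ :: _); apply: (IHp _ _ _ sd se cW).
have sub f x y : size f = size p -> (x, y) \in encode (V :\ v) p f ->
    [/\ x \in V, y \in V, (x == v) = false & (y == v) = false].
  move=> sf; move/(saturated_in (saturated_encode cW sf)); rewrite !inE.
  by case/andP => /andP[/negPf-> ->] /andP[/negPf-> ->].
apply/setP => -[x y]; have /setP/(_ (x, y)) := EE; rewrite !inE /=.
move=> h; apply/idP/idP => xyE.
  by have [xV yV xv yv] := sub _ _ _ sd xyE; move: h; rewrite xV yV xv yv xyE.
by have [xV yV xv yv] := sub _ _ _ se xyE; move: h; rewrite xV yV xv yv xyE.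
Qed.

(** This is the star with centre [c] and leaves ordered as in [p]. As [c] is not in [p], its index
    is [size p], so [c] comes last. A new first leaf [x] is split off by the single arc [(c, x)]. *)
Lemma saturated_star c p : uniq (c :: p) ->
  saturated [set x in c :: p]
    [set e in setX [set x in c :: p] [set x in c :: p] |
      (e.1 == c) || (index e.1 p <= index e.2 p)].
Proof.
elim: p => [|x p IHp].
  move=> _; have -> : [set x in [:: c]] = [set c] by apply/setP => x; rewrite !inE.
  have -> : [set e in setX [set c] [set c] | (e.1 == c) || (index e.1 [::] <= index e.2 [::])]
    = [set (c, c)]; last exact: saturated1.
  by apply/setP => -[x y]; rewrite !inE /= orbT andbT.
move=> uc; have /IHp sp : uniq (c :: p).
  by move: uc; rewrite /= inE negb_or => /and3P[/andP[_ ->] _ ->].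
have [cx xp] : c != x /\ x \notin p.
  by move: uc; rewrite /= inE negb_or => /and3P[/andP[-> _] ->].
have -> : [set y in c :: x :: p] = [set y in c :: p] :|: [set x].
  by apply/setP => y; rewrite !inE; do 3 case: (_ \in _) || case: (_ == _).
set V := [set y in c :: p] in sp *; set E := [set e in _ | _] in sp *.
have xV : x \notin V by rewrite !inE negb_or eq_sym cx.
have xc : (x == c) || (x \in p) = false by rewrite eq_sym (negPf cx) (negPf xp).
have -> : [set e in setX (V :|: [set x]) (V :|: [set x]) |
     (e.1 == c) || (index e.1 (x :: p) <= index e.2 (x :: p))] =
    (c, x) |: (E :|: [set (x, x)] :|: setX [set x] V).
  apply/setP => -[y z]; rewrite !(in_setU, in_set1, in_setX, inE) /= !xpair_eqE.
  have [yx|yx] := eqVneq x y; have [zx|zx] := eqVneq x z; subst => /=.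
  - by rewrite !orbT.
  - by rewrite leq0n !orbT !orbF !andbT; case: (z == c); case: (z \in p); rewrite /= ?orbT ?andbF.
  - by rewrite ltn0 xc !orbT !orbF !andbT andbF; case: (y == c); rewrite /= ?andbF.
  - by rewrite ltnS !andbF !orbF.
apply: saturatedU; rewrite ?set11 //; last exact: saturated1.
  by rewrite disjoint_sym disjoints1.
by rewrite !inE eqxx.
Qed.

End Directed.

(** * The encoded facets and one further facet *)

Section LowerBound.

Variable n : nat.
Hypothesis n_ge4 : 4 <= n.

Local Notation word := ((n - 2).-tuple 'I_n).

Lemma exists_unencoded : exists E : {set 'I_n * 'I_n}, saturated setT E /\
  forall (p : word) (d : (n - 2).-tuple bool), encode setT p d <> E.
Proof.
have n2 : 2 <= n by lia.
have fresh (p : seq 'I_n) : size p < n -> exists x, x \notin p.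
  move=> sp; case: (pickP [pred x | x \notin p]) => [x xp|no]; first by exists x.
  have : #|'I_n| <= #|p| by apply: subset_leq_card; apply/subsetP => x _; have := no x => /negbFE.
  by rewrite card_ord => /leq_trans/(_ (card_size _)); rewrite leqNgt sp.
have [c _] := fresh [::] ltac:(simpl; lia).
(* The leaf that [prufer] removes first when [c] is the only letter of the code. *)
have [v pv] : exists v, [pick v in [set: 'I_n] | v != c] = Some v.
  case: pickP => [v _|no]; first by exists v.
  have [x] := fresh [:: c] ltac:(simpl; lia).
  by rewrite inE => xc; have := no x; rewrite inE xc.
have vc : v != c by move: pv; case: pickP => // x /andP[_ xc] [<-].
have [w1] := fresh [:: c; v] ltac:(simpl; lia).
rewrite !inE !negb_or => /andP[w1c w1v].
have [w2] := fresh [:: c; v; w1] ltac:(simpl; lia).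
rewrite !inE !negb_or => /and3P[w2c w2v w2w1].
(* In this order of the leaves [v] is second: [w1] comes before it and [w2] after it. *)
pose s := [:: w1, v & enum [set x | x \notin [:: c; v; w1]]].
have us : uniq (c :: s).
  rewrite /= !inE !mem_enum !inE enum_uniq !eqxx !orbT /= !negb_or.
  by rewrite ![c == _]eq_sym w1c vc w1v.
have sT : [set x in c :: s] = setT.
  apply/setP => x; rewrite !inE mem_enum !inE.
  by do 3 case: (_ == _).
have ltw1 : index w1 s < index v s by rewrite /= !eqxx (negPf w1v).
have ltw2 : index v s < index w2 s.
  by rewrite /= eqxx (negPf w1v) ![_ == w2]eq_sym (negPf w2w1) (negPf w2v).
(* From here on only these properties of [s] are used, so its value is forgotten. *)
move: s us sT ltw1 ltw2 => s us sT ltw1 ltw2.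
have := saturated_star us; rewrite sT; set E := [set e in _ | _] => sE.
exists E; split=> // p d EE.
have memE x y : (x, y) \in E = (x == c) || (index x s <= index y s).
  by rewrite !inE.
have cp := prufer_code_word n2 p.
have sd : size d = size p by rewrite !size_tuple.
have index_inj x y : x != c -> index x s = index y s -> x = y.
  move=> xc h; have xs : x \in s.
    by have /setP/(_ x) := sT; rewrite in_setT in_set in_cons (negPf xc).
  by have := nth_index x xs; rewrite h nth_index // -index_mem -h index_mem.
have cs : index c s = size s by apply: memNindex; case/andP: us.
(* An encoding of [E] would have the star as its tree, so [c] would be the only letter of [p]. *)
have dbl x y : (x, y) \in prufer setT p = (x != y) && ((x == c) || (y == c)).
  rewrite -(two_way_encode cp sd) EE inE /= !memE; case: (eqVneq x y) => [->|xy] /=.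
    by rewrite andbF.
  have [->|xc] := eqVneq x c; first by rewrite /= cs index_size orbT.
  have [->|yc] := eqVneq y c; first by rewrite /= cs index_size.
  by rewrite /= -eqn_leq; apply/eqP => /(index_inj _ _ xc) h; rewrite h eqxx in xy.
have notin_p x : (x \notin tval p) = (x != c).
  rewrite (notin_prufer_code cp) ?inE //; have [->|xc] /= := eqVneq x c.
    have : 1 < #|nbr (prufer setT p) c|.
      apply/card_gt1P; exists v, w1; rewrite [v == _]eq_sym.
      by split; rewrite // inE dbl eqxx [c == _]eq_sym ?vc ?w1c.
    by case: #|_| => [|[]].
  have -> : nbr (prufer setT p) x = [set c]; last by rewrite cards1.
  apply/setP => y; rewrite !inE dbl (negPf xc) /=.
  by case: (eqVneq y c) => [->|]; rewrite ?xc ?andbF.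
have {}sd : size d = n - 2 by rewrite size_tuple.
have sp : size p = n - 2 by rewrite size_tuple.
case: (tval p) (tval d) sp sd cp notin_p EE => [|u q] [|t e] sp sd cp notin_p;
  try by move: sp sd => /=; lia.
have [v' [pv' _ vq uW _]] := prufer_code_pick cp.
have vv' : v' = v.
  by apply: Some_inj; rewrite -pv' -pv; apply: eq_pick => x; rewrite /= -notin_p.
have uc : u = c by apply/eqP; have := notin_p u; rewrite inE eqxx; case: eqP.
rewrite [encode _ _ _]/= pv' vv' uc => /setP EE.
(* In the encoding, [(v, w1)] and [(v, w2)] are both present or both absent, according to the first
   bit; [E] contains only the second. *)
have := EE (v, w1); have := EE (v, w2).
rewrite !memE !inE /= eqxx (negPf w1v) (negPf w2v) (negPf w1c) (negPf w2c) (negPf vc) /=.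
by rewrite [_ <= index w1 _]leqNgt ltw1 (ltnW ltw2) /= => ->.
Qed.

(** Injectivity of [encode] gives as many facets as there are pairs of a code and a bit string, and
    the star from [exists_unencoded] makes the inequality strict. *)
Lemma num_facets_gt : 2 ^ (n - 2) * n ^ (n - 2) < num_facets n.
Proof.
have n0 : 0 < n by lia.
have n2 : 2 <= n by lia.
pose f (pd : word * (n - 2).-tuple bool) := encode setT pd.1 pd.2.
have injf : injective f.
  move=> [p d] [q e] EE.
  have sz (r : word) (c : (n - 2).-tuple bool) : size c = size r by rewrite !size_tuple.
  have [/val_inj-> /val_inj->//] :=
    encode_inj (prufer_code_word n2 p) (prufer_code_word n2 q) (sz p d) (sz q e) EE.
have -> : 2 ^ (n - 2) * n ^ (n - 2) = #|[set f pd | pd in setT]|.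
  by rewrite card_imset // cardsT card_prod !card_tuple card_ord card_bool mulnC.
have [E0 [sE0 nE0]] := exists_unencoded.
rewrite num_facetsE //; apply: proper_card; apply/properP; split.
  apply/subsetP => _ /imsetP[[p d] _ ->]; rewrite inE; apply/facet_with_zero => //.
  by apply: saturated_encode; [exact: prufer_code_word | rewrite !size_tuple].
exists E0; first by rewrite inE; apply/facet_with_zero.
by apply/imsetP => -[[p d] _ /esym/nE0].
Qed.

End LowerBound.

Theorem theorem5p24 :
  (forall n : nat, 2 <= n -> num_facets n < n`! * n ^ (n - 2)) /\
  (forall n : nat, 4 <= n -> 2 ^ (n - 2) * n ^ (n - 2) < num_facets n).
Proof. by split=> n; [exact: num_facets_lt | exact: num_facets_gt]. Qed.
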